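(* Let $\mathcal{G}=(G,[\ ],\oplus_1,\ldots,\oplus_n)$ be a Menger $(2,n)$-semigroup that satisfies the conditions (R1)–(R4) listed in the context. Then every representation of $\mathcal{G}$ by $n$-place functions is the union of some family of simplest representations of $\mathcal{G}$.
   Context: A Menger $(2,n)$-semigroup $(G,[\ ],\oplus_1,\ldots,\oplus_n)$ is a set $G$ with associative binary operations $\oplus_1,\ldots,\oplus_n$ and an $(n+1)$-ary operation $[\ ]$ with $[[x,y_1,\ldots,y_n],z_1,\ldots,z_n]=[x,[y_1,z_1,\ldots,z_n],\ldots,[y_n,z_1,\ldots,z_n]]$. Notation: $x_i^j$ is the sequence $x_i,\ldots,x_j$ (empty if $i>j$). $n$-place functions on a set $A$ are partial maps $A^n\to A$, with operations $[f,g_1^n](\bar a)=f(g_1(\bar a),\ldots,g_n(\bar a))$ and $(f\oplus_ig)(\bar a)=f(a_1^{i-1},g(\bar a),a_{i+1}^n)$ (both sides defined or undefined simultaneously). A representation of $\mathcal{G}$ by $n$-place functions on $A$ is a map $P$ from $G$ to $n$-place functions on $A$ with $P([x,y_1^n])=[P(x),P(y_1),\ldots,P(y_n)]$ and $P(x\oplus_iy)=P(x)\oplus_iP(y)$ for all $x,y,y_1,\ldots,y_n\in G$ and $i=1,\ldots,n$ (not necessarily injective). Products are left-bracketed: $x\oplus_{i_1}y_1\cdots\oplus_{i_s}y_s=(\cdots(x\oplus_{i_1}y_1)\cdots)\oplus_{i_s}y_s$. For a formal string with $x_j\in G$ and $i_j\in\{1,\ldots,n\}$, $\mu_i(\oplus_{i_1}x_1\cdots\oplus_{i_s}x_s)$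 is $x_k\oplus_{i_{k+1}}x_{k+1}\cdots\oplus_{i_s}x_s$, where $k$ is the first position with $i_k=i$, and it is empty if $i\notin\{i_1,\ldots,i_s\}$. Given selectors $e_1,\ldots,e_n$ (below), $\mu_i^*(\cdots)=\mu_i(\cdots)$ if non-empty and $\mu_i^*(\cdots)=e_i$ if $\mu_i(\cdots)$ is empty. Conditions on $\mathcal{G}$ (for all elements of $G$, all $i$, and all index sequences in $\{1,\ldots,n\}$): (R1) $[x\oplus_iy,z_1^n]=[x,z_1^{i-1},[y,z_1^n],z_{i+1}^n]$; (R2) $[x,y_1^n]\oplus_iz=[x,y_1\oplus_iz,\ldots,y_n\oplus_iz]$; (R3) $x\oplus_{i_1}y_1\cdots\oplus_{i_s}y_s=[x,\mu_1(\oplus_{i_1}y_1\cdots\oplus_{i_s}y_s),\ldots,\mu_n(\oplus_{i_1}y_1\cdots\oplus_{i_s}y_s)]$ if $\{i_1,\ldots,i_s\}=\{1,\ldots,n\}$; (R4) if for every $i=1,\ldots,n$ the symbols $\mu_i(\oplus_{i_1}x_1\cdots\oplus_{i_s}x_s)$ and $\mu_i(\oplus_{j_1}y_1\cdots\oplus_{j_k}y_k)$ are equal (both empty, or both non-empty and equal in $G$), then $g\oplus_{i_1}x_1\cdots\oplus_{i_s}x_s=g\oplus_{j_1}y_1\cdots\oplus_{j_k}y_k$ for every $g\in G$. A Menger $(2,n)$-semigroup is unitary if it contains selectors, i.e. elements $e_1,\ldots,e_n$ with $[x,e_1^n]=x$, $[e_i,x_1^n]=x_i$ and $[x,e_1^{i-1},y,e_{i+1}^n]=x\oplus_iy$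 for all $i$ and all elements. A unitary extension of $\mathcal{G}$ is a unitary Menger $(2,n)$-semigroup $\mathcal{G}^*=(G^*,[\ ],\oplus_1,\ldots,\oplus_n)$ with selectors $e_1,\ldots,e_n$ such that $G\subset G^*$ (the operations of $\mathcal{G}^*$ extending those of $\mathcal{G}$), $G\cap\{e_1,\ldots,e_n\}=\emptyset$, and $G\cup\{e_1,\ldots,e_n\}$ generates $\mathcal{G}^*$. A determining pair of $\mathcal{G}$ is a pair $(\mathcal{E},W)$, where $\mathcal{E}$ is a symmetric and transitive relation on a unitary extension $\mathcal{G}^*$ of $\mathcal{G}$ and $W\subset G^*$. Write $\mathcal{E}\langle g\rangle$ for the $\mathcal{E}$-class of $g$, $\mathcal{E}(G)=\{y:\exists x\in G,\ (x,y)\in\mathcal{E}\}$, and $[g,X_1,\ldots,X_n]=\{[g,x_1,\ldots,x_n]:x_i\in X_i\}$. It is required that: (i) $G\cup\{e_1,\ldots,e_n\}$ is contained in the domain of $\mathcal{E}$; (ii) $\{e_1,\ldots,e_n\}\cap W=\emptyset$; (iii) $[g,\mathcal{E}\langle e_1\rangle,\ldots,\mathcal{E}\langle e_n\rangle]\subset\mathcal{E}\langle g\rangle$ for all $g\in G$; (iv) $[g,\mathcal{E}\langle\mu_1^*(\oplus_{i_1}y_1\cdots\oplus_{i_s}y_s)\rangle,\ldots,\mathcal{E}\langle\mu_n^*(\oplus_{i_1}y_1\cdots\oplus_{i_s}y_s)\rangle]\subset\mathcal{E}\langle g\oplus_{i_1}y_1\cdots\oplus_{i_s}y_s\rangle$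 for all $g,y_1,\ldots,y_s\in G$ and $i_1,\ldots,i_s\in\{1,\ldots,n\}$; (v) $\rho=\mathcal{E}\cap(\mathcal{E}(G)\times\mathcal{E}(G))$ is $v$-regular in $\mathcal{G}^*$: if $(x,y),(x_1,y_1),\ldots,(x_n,y_n)\in\rho$, then $([g,x_1^n],[g,y_1^n])\in\rho$ and $(g\oplus_ix,g\oplus_iy)\in\rho$ for all $g\in G$, $i=1,\ldots,n$; (vi) if $W\ne\emptyset$, then $W$ is an $\mathcal{E}$-class and $W\cap G$ is an $l$-ideal of $\mathcal{G}$, where $V\subset G$ is an $l$-ideal if $[g,w_1^{i-1},x,w_{i+1}^n]\in V$ and $g\oplus_ix\in V$ for all $g,w_1,\ldots,w_n\in G$, $x\in V$, $i=1,\ldots,n$. Given a determining pair $(\mathcal{E},W)$, let $(H_a)_{a\in A}$ be the collection of all $\mathcal{E}$-classes $H$ with $H\ne W$ and $H\cap(G\cup\{e_1,\ldots,e_n\})\ne\emptyset$, uniquely indexed by the elements of a set $A$. Let $\mathfrak{A}\subset A^n$ consist of exactly those $(a_1,\ldots,a_n)$ for which one of the following holds: (a) $H_{a_i}=\mathcal{E}\langle g_i\rangle$, $i=1,\ldots,n$, for some $g_1,\ldots,g_n\in G$; (b) $H_{a_i}=\mathcal{E}\langle e_i\rangle$, $i=1,\ldots,n$; (c) $H_{a_i}=\mathcal{E}\langle\mu_i^*(\oplus_{i_1}y_1\cdots\oplus_{i_s}y_s)\rangle$, $i=1,\ldots,n$, for some $y_1,\ldots,y_s\in G$ and $i_1,\ldots,i_s\in\{1,\ldots,n\}$.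 For $g\in G$ define the $n$-place function $P_{(\mathcal{E},W)}(g)$ on $A$ by $$(a_1^n,b)\in P_{(\mathcal{E},W)}(g)\iff a_1^n\in\mathfrak{A}\ \wedge\ [g,H_{a_1},\ldots,H_{a_n}]\subset H_b.$$ The map $g\mapsto P_{(\mathcal{E},W)}(g)$ is called the simplest representation induced by $(\mathcal{E},W)$ (the index set $A$ may be chosen arbitrarily). The union of a family $(P_i)_{i\in I}$ of representations of $\mathcal{G}$ by $n$-place functions on sets $A_i$ is the map $P$ with $P(g)=\bigcup_{i\in I}P_i(g)$ (union of functions as sets of pairs) for $g\in G$, considered on $A=\bigcup_{i\in I}A_i$. *)

(* Defs.v *)
From mathcomp Require Import all_boot.
From mathcomp Require Import boolp classical_sets functions.

Set Implicit Arguments.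
Unset Strict Implicit.
Unset Printing Implicit Defensive.

Local Open Scope classical_set_scope.

(* Sequences x_1, ..., x_n are functions 'I_n -> T; positions are counted from
   0. [upd x i y] is the sequence x_1, ..., x_{i-1}, y, x_{i+1}, ..., x_n. *)
Definition upd (n : nat) (T : Type) (x : 'I_n -> T) (i : 'I_n) (y : T) :
    'I_n -> T :=
  fun j => if j == i then y else x j.

(* [mcomp x y] is [x, y_1, ..., y_n] and [oplus i x y] is x (+)_i y. *)
Record menger2 (n : nat) := Menger2 {
  mcarrier :> Type;
  mcomp : mcarrier -> ('I_n -> mcarrier) -> mcarrier;
  oplus : 'I_n -> mcarrier -> mcarrier -> mcarrier;
  oplusA : forall i : 'I_n, associative (oplus i);
  mcompA : forall (x : mcarrier) (y z : 'I_n -> mcarrier),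
    mcomp (mcomp x y) z = mcomp x (fun i => mcomp (y i) z)
}.

Section Conditions.
Variables (n : nat) (G : menger2 n).

(* A formal string (+)_{i_1} x_1 ... (+)_{i_s} x_s is the list of the pairs
   (i_k, x_k); [oplus_string x s] is the left-bracketed product of x by s. *)
Definition oplus_string (x : G) (s : seq ('I_n * G)) : G :=
  foldl (fun z p => oplus p.1 z p.2) x s.

(* [None] stands for the empty symbol. *)
Fixpoint mu (i : 'I_n) (s : seq ('I_n * G)) : option G :=
  if s is (j, x) :: s' then
    if j == i then Some (oplus_string x s') else mu i s'
  else None.

Definition cond_R1 : Prop :=
  forall (i : 'I_n) (x y : G) (z : 'I_n -> G),
    mcomp (oplus i x y) z = mcomp x (upd z i (mcomp y z)).

Definition cond_R2 : Prop :=
  forall (i : 'I_n) (x z : G) (y : 'I_n -> G),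
    oplus i (mcomp x y) z = mcomp x (fun j => oplus i (y j) z).

(* Under the hypothesis no [mu i s] is [None], so the default value [x] of
   [odflt] is never used. *)
Definition cond_R3 : Prop :=
  forall (x : G) (s : seq ('I_n * G)),
    (forall i : 'I_n, i \in unzip1 s) ->
    oplus_string x s = mcomp x (fun i => odflt x (mu i s)).

Definition cond_R4 : Prop :=
  forall s t : seq ('I_n * G),
    (forall i : 'I_n, mu i s = mu i t) ->
    forall g : G, oplus_string g s = oplus_string g t.

Definition l_ideal (V : set G) : Prop :=
  forall (i : 'I_n) (g x : G) (w : 'I_n -> G),
    V x -> V (mcomp g (upd w i x)) /\ V (oplus i g x).

Definition subalgebra (S : set G) : Prop :=
  (forall (x : G) (y : 'I_n -> G),
     S x -> (forall i, S (y i)) -> S (mcomp x y)) /\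
  (forall (i : 'I_n) (x y : G), S x -> S y -> S (oplus i x y)).

Definition selectors (e : 'I_n -> G) : Prop :=
  [/\ forall x : G, mcomp x e = x,
      forall (i : 'I_n) (x : 'I_n -> G), mcomp (e i) x = x i
    & forall (i : 'I_n) (x y : G), mcomp x (upd e i y) = oplus i x y].

Definition mcomp_set (g : G) (X : 'I_n -> set G) : set G :=
  [set mcomp g x | x in [set x : 'I_n -> G | forall i, X i (x i)]].

End Conditions.

(* The inclusion of G in G* is an injective homomorphism [emb]. *)
Record unitary_extension (n : nat) (G : menger2 n) := UnitaryExtension {
  uext :> menger2 n;
  sel : 'I_n -> uext;
  emb : G -> uext;
  sel_selectors : selectors sel;
  emb_inj : injective emb;
  emb_mcomp : forall (x : G) (y : 'I_n -> G),
    emb (mcomp x y) = mcomp (emb x) (fun i => emb (y i));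
  emb_oplus : forall (i : 'I_n) (x y : G),
    emb (oplus i x y) = oplus i (emb x) (emb y);
  emb_sel_disjoint : range emb `&` range sel = set0;
  uext_generated :
    smallest (@subalgebra n uext) (range emb `|` range sel) = setT
}.

Section DeterminingPair.
Variables (n : nat) (G : menger2 n) (U : unitary_extension G).

Definition mu_star (i : 'I_n) (s : seq ('I_n * G)) : U :=
  if mu i s is Some g then emb U g else sel U i.

Definition rel_dom (E : U -> U -> Prop) : set U := [set x | exists y, E x y].

Definition eclass (E : U -> U -> Prop) (g : U) : set U := [set y | E g y].

Definition is_eclass (E : U -> U -> Prop) (H : set U) : Prop :=
  exists2 x, rel_dom E x & H = eclass E x.

Definition esaturation (E : U -> U -> Prop) : set U :=
  [set y | exists x : G, E (emb U x) y].

Definition erho (E : U -> U -> Prop) (x y : U) : Prop :=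
  [/\ E x y, esaturation E x & esaturation E y].

Definition v_regular (r : U -> U -> Prop) : Prop :=
  forall (x y : U) (xs ys : 'I_n -> U),
    r x y -> (forall i, r (xs i) (ys i)) ->
    forall g : G,
      r (mcomp (emb U g) xs) (mcomp (emb U g) ys) /\
      (forall i : 'I_n, r (oplus i (emb U g) x) (oplus i (emb U g) y)).

Record determining_pair (E : U -> U -> Prop) (W : set U) : Prop := {
  dp_sym : forall x y, E x y -> E y x;
  dp_trans : forall x y z, E x y -> E y z -> E x z;
  dp_dom : range (emb U) `|` range (sel U) `<=` rel_dom E;
  dp_selW : range (sel U) `&` W = set0;
  dp_sel : forall g : G,
    mcomp_set (emb U g) (fun i => eclass E (sel U i))
      `<=` eclass E (emb U g);
  dp_mu_star : forall (g : G) (s : seq ('I_n * G)),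
    mcomp_set (emb U g) (fun i => eclass E (mu_star i s))
      `<=` eclass E (emb U (oplus_string g s));
  dp_v_regular : v_regular (erho E);
  dp_W : W !=set0 -> is_eclass E W /\ l_ideal (emb U @^-1` W)
}.

Definition index_classes (E : U -> U -> Prop) (W : set U) : set (set U) :=
  [set H | [/\ is_eclass E H, H <> W
             & H `&` (range (emb U) `|` range (sel U)) !=set0]].

Definition domain_tuples (X : Type) (B : set X) (H : X -> set U)
    (E : U -> U -> Prop) : set ('I_n -> X) :=
  [set a | (forall i, B (a i)) /\
    [\/ exists g : 'I_n -> G, forall i, H (a i) = eclass E (emb U (g i)),
        forall i, H (a i) = eclass E (sel U i)
      | exists s : seq ('I_n * G), forall i, H (a i) = eclass E (mu_star i s)]].

Definition pair_representation (X : Type) (B : set X) (H : X -> set U)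
    (E : U -> U -> Prop) (g : G) : set (('I_n -> X) * X) :=
  [set p | [/\ domain_tuples B H E p.1, B p.2
             & mcomp_set (emb U g) (fun i => H (p.1 i)) `<=` H p.2]].

End DeterminingPair.

(* Sets on which functions act are subsets of an ambient type X, so that the
   members of a family may act on different, possibly overlapping sets.
   An n-place function is identified with its graph. *)
Section Representations.
Variables (n : nat) (X : Type).

Definition nplace_function (A : set X) (F : set (('I_n -> X) * X)) : Prop :=
  (forall a b, F (a, b) -> (forall i, A (a i)) /\ A b) /\
  (forall a b c, F (a, b) -> F (a, c) -> b = c).

Definition fun_mcomp (F : set (('I_n -> X) * X))
    (K : 'I_n -> set (('I_n -> X) * X)) : set (('I_n -> X) * X) :=
  [set p | exists b : 'I_n -> X, (forall i, K i (p.1, b i)) /\ F (b, p.2)].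

Definition fun_oplus (i : 'I_n) (F K : set (('I_n -> X) * X)) :
    set (('I_n -> X) * X) :=
  [set p | exists b : X, K (p.1, b) /\ F (upd p.1 i b, p.2)].

Definition representation (G : menger2 n) (A : set X)
    (P : G -> set (('I_n -> X) * X)) : Prop :=
  [/\ forall g : G, nplace_function A (P g),
      forall (x : G) (y : 'I_n -> G),
        P (mcomp x y) = fun_mcomp (P x) (fun i => P (y i))
    & forall (i : 'I_n) (x y : G),
        P (oplus i x y) = fun_oplus i (P x) (P y)].

Definition simplest_representation (G : menger2 n) (B : set X)
    (Q : G -> set (('I_n -> X) * X)) : Prop :=
  exists (U : unitary_extension G) (E : U -> U -> Prop) (W : set U)
         (H : X -> set U),
    [/\ determining_pair E W,
        set_bij B (index_classes E W) H
      & forall g : G, Q g = pair_representation B H E g].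

Definition is_union_of (G : menger2 n) (A : set X)
    (P : G -> set (('I_n -> X) * X)) (I : Type) (B : I -> set X)
    (Q : I -> G -> set (('I_n -> X) * X)) : Prop :=
  A = \bigcup_(k in setT) B k /\
  forall g : G, P g = \bigcup_(k in setT) Q k g.

End Representations.

(* Main.v *)
(** Adjoining a sink [None] turns n-place functions into total functions in
    which the projections are genuine selectors, so a representation becomes a
    homomorphism into a unitary algebra. Conditions (R1)-(R4) say exactly that
    [g] acts on the tuples over [G + {e_1, ..., e_n}] of the form
    [h_1, ..., h_n] or [mu*_1 s, ..., mu*_n s] by [g, h_1, ..., h_n] and
    [g (+) s] respectively; this representation is faithful since
    [g] sends [e_1, ..., e_n] to [g]. The elements of [G], acting by it and by
    [P] simultaneously, generate together with the projections a unitary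
    extension [G*] on which [P] extends to [P*]. For a tuple [a] in [A^n], the
    relation [P* x a = P* y a] with [W = {x | P* x a undefined}] is a
    determining pair whose simplest representation is contained in [P] and
    agrees with [P] at [a]; [P] is the union of these over all [a]. *)
Require Import Defs.
From mathcomp Require Import all_boot.
From mathcomp Require Import boolp classical_sets functions.

Set Implicit Arguments.
Unset Strict Implicit.
Unset Printing Implicit Defensive.

Local Open Scope classical_set_scope.

(** * The algebra of total n-place functions, with projections as selectors *)

Section TotalFunctions.
Variables (n : nat) (Y : Type).

Lemma upd_upd (a : 'I_n -> Y) i x y : upd (upd a i x) i y = upd a i y.
Proof. by apply/funext => j; rewrite /upd; case: eqP. Qed.

Definition tfun : Type := ('I_n -> Y) -> Y.

Definition tfun_mcomp (f : tfun) (g : 'I_n -> tfun) : tfun :=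
  fun a => f (fun i => g i a).

Definition tfun_oplus (i : 'I_n) (f g : tfun) : tfun :=
  fun a => f (upd a i (g a)).

Lemma tfun_oplusA i : associative (tfun_oplus i).
Proof. by move=> f g h; apply/funext => a; rewrite /tfun_oplus upd_upd. Qed.

Lemma tfun_mcompA f g h :
  tfun_mcomp (tfun_mcomp f g) h = tfun_mcomp f (fun i => tfun_mcomp (g i) h).
Proof. by []. Qed.

Definition tfun_menger : menger2 n := Menger2 tfun_oplusA tfun_mcompA.

Lemma tfun_selectors : @selectors n tfun_menger (fun i a => a i).
Proof.
split=> // i f g; apply/funext => a /=; rewrite /tfun_mcomp /tfun_oplus.
by congr (f _); apply/funext => j; rewrite /upd; case: eqP.
Qed.

End TotalFunctions.

(** * Direct products and their selectors *)

Section Product.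
Variables (n : nat) (V W : menger2 n).

Definition prod_mcomp (x : V * W) (y : 'I_n -> V * W) : V * W :=
  (mcomp x.1 (fun i => (y i).1), mcomp x.2 (fun i => (y i).2)).

Definition prod_oplus (i : 'I_n) (x y : V * W) : V * W :=
  (oplus i x.1 y.1, oplus i x.2 y.2).

Lemma prod_oplusA i : associative (prod_oplus i).
Proof. by move=> x y z; rewrite /prod_oplus /= !oplusA. Qed.

Lemma prod_mcompA x y z :
  prod_mcomp (prod_mcomp x y) z = prod_mcomp x (fun i => prod_mcomp (y i) z).
Proof. by rewrite /prod_mcomp /= !mcompA. Qed.

Definition prod_menger : menger2 n := Menger2 prod_oplusA prod_mcompA.

Lemma prod_selectors (e : 'I_n -> V) (f : 'I_n -> W) :
  selectors e -> selectors f ->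
  @selectors n prod_menger (fun i => (e i, f i)).
Proof.
case=> e1 e2 e3 [f1 f2 f3]; split=> [[x y]|i x|i x y] /=; rewrite /prod_mcomp /=.
- by rewrite e1 f1.
- by rewrite e2 f2; case: (x i).
- rewrite /prod_oplus -e3 -f3.
  by congr (mcomp _ _, mcomp _ _); apply/funext => j; rewrite /upd; case: eqP.
Qed.

End Product.

(** * Generated subalgebras, carried by a subtype *)

Section GeneratedExtension.
Variables (n : nat) (V : menger2 n) (S : set V).

Let gen : set V := smallest (@subalgebra n V) S.

Lemma gen_sub : S `<=` gen.
Proof. exact: sub_gen_smallest. Qed.

Lemma gen_subalgebra : @subalgebra n V gen.
Proof.
split=> [x y gx gy|i x y gx gy] T TS; have [[Tm To] _] := TS.
- by apply: Tm => [|i]; [exact: gx|exact: gy].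
- by apply: To; [exact: gx|exact: gy].
Qed.

Definition gen_mcomp (x : {x | gen x}) (y : 'I_n -> {x | gen x}) :
    {x | gen x} :=
  exist _ _ (gen_subalgebra.1 _ _ (proj2_sig x) (fun i => proj2_sig (y i))).

Definition gen_oplus (i : 'I_n) (x y : {x | gen x}) : {x | gen x} :=
  exist _ _ (gen_subalgebra.2 i _ _ (proj2_sig x) (proj2_sig y)).

Lemma gen_oplusA i : associative (gen_oplus i).
Proof. by move=> x y z; apply/eq_exist/oplusA. Qed.

Lemma gen_mcompA x y z :
  gen_mcomp (gen_mcomp x y) z = gen_mcomp x (fun i => gen_mcomp (y i) z).
Proof. exact/eq_exist/mcompA. Qed.

Definition gen_menger : menger2 n := Menger2 gen_oplusA gen_mcompA.

(** A subalgebra [M] of the subtype that contains [T] projects to a subalgebra of [V] containing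
    [S], hence containing [gen]; proof irrelevance identifies the membership proofs. *)
Lemma gen_generated (T : set gen_menger) :
  (forall v (Sv : S v), T (exist _ v (gen_sub Sv))) ->
  smallest (@subalgebra n gen_menger) T = setT.
Proof.
move=> ST; apply/seteqP; split=> // -[v gv] _ M [[Mm Mo] TM].
have [gv' Mv] : exists gv' : gen v, M (exist _ v gv').
  refine (gv [set v | exists gv' : gen v, M (exist _ v gv')] _); split.
    split=> [x y [gx Mx] My|i x y [gx Mx] [gy My]].
    (* Choice turns the pointwise membership proofs of [My] into a tuple of the subtype. *)
    - pose y' i : gen_menger := exist _ (y i) (projT1 (cid (My i))).
      have My' i : M (y' i) by exact: (projT2 (cid (My i))).
      by exists (proj2_sig (gen_mcomp (exist _ x gx) y')); exact: (Mm _ _ Mx My').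
    - exists (proj2_sig (gen_oplus i (exist _ x gx) (exist _ y gy))).
      exact: (Mo i _ _ Mx My).
  by move=> x Sx; exists (gen_sub Sx); apply/TM/ST.
by rewrite (Prop_irrelevance gv gv').
Qed.

End GeneratedExtension.

(** * From an embedding into an algebra with selectors to a unitary extension *)

Section ExtensionOfEmbedding.
Variables (n : nat) (G V : menger2 n) (f : G -> V) (e : 'I_n -> V).
Hypotheses (sel_e : selectors e) (f_inj : injective f).
Hypothesis f_mcomp :
  forall x y, f (mcomp x y) = mcomp (f x) (fun i => f (y i)).
Hypothesis f_oplus : forall i x y, f (oplus i x y) = oplus i (f x) (f y).
Hypothesis f_e : forall x i, f x <> e i.

(** The carrier of [U] is the subalgebra of [V] generated by [range f] and [range e], and [p] is its
    inclusion. *)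
Lemma extension_of_embedding :
  exists (U : unitary_extension G) (p : U -> V),
    [/\ forall x y, p (mcomp x y) = mcomp (p x) (fun i => p (y i)),
        forall i x y, p (oplus i x y) = oplus i (p x) (p y),
        forall g, p (emb U g) = f g
      & forall i, p (sel U i) = e i].
Proof.
pose S := range f `|` range e.
have Sf g : S (f g) by left; exists g.
have Se i : S (e i) by right; exists i.
pose W := gen_menger S.
pose em (g : G) : W := exist _ _ (gen_sub (Sf g)).
pose se (i : 'I_n) : W := exist _ _ (gen_sub (Se i)).
have W_eq (x y : W) : proj1_sig x = proj1_sig y -> x = y.
  by case: x y => [x hx] [y hy] /= xy; apply/eq_exist.
have seW : @selectors n W se.
  case: sel_e => e1 e2 e3; split=> [x|i x|i x y]; apply: W_eq => /=.
  - exact: e1.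
  - exact: e2.
  - rewrite -e3; congr (mcomp _ _).
    by apply/funext => j; rewrite /upd; case: eqP.
have em_inj : injective em by move=> x y /(congr1 (@proj1_sig _ _)) /f_inj.
have em_m x y : em (mcomp x y) = mcomp (em x) (fun i => em (y i)).
  by apply: W_eq; exact: f_mcomp.
have em_o i x y : em (oplus i x y) = oplus i (em x) (em y).
  by apply: W_eq; exact: f_oplus.
have em_se : range em `&` range se = set0.
  apply/seteqP; split=> // _ [[x _ <-] [i _ /(congr1 (@proj1_sig _ _))]] /=.
  by move=> /esym/f_e.
have em_gen : smallest (@subalgebra n W) (range em `|` range se) = setT.
  apply: gen_generated => v Sv; have [[g _ gv]|[i _ iv]] := Sv.
  - by left; exists g => //; apply: W_eq.
  - by right; exists i => //; apply: W_eq.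
by exists (UnitaryExtension seW em_inj em_m em_o em_se em_gen), (@proj1_sig _ _).
Qed.

End ExtensionOfEmbedding.

(** * Partial functions as strict total functions on [option X] *)

Section SinkExtension.
Variables (n : nat) (X : Type).
Hypothesis n_gt0 : (0 < n)%N.

(** A tuple with a [None] entry is never of the form [Some \o c], hence is sent to [None]. The
    chosen value is unique once [F] is the graph of a function. *)
Definition sink_ext (F : set (('I_n -> X) * X)) : tfun_menger n (option X) :=
  fun a => if pselect (exists b c, a = Some \o c /\ F (c, b)) is left ex
           then Some (projT1 (cid ex)) else None.

Lemma sink_extP (A : set X) F a b : nplace_function A F ->
  sink_ext F a = Some b <-> exists c, a = Some \o c /\ F (c, b).
Proof.
case=> _ Ffun; rewrite /sink_ext; case: pselect => [ex|nex]; last first.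
  by split=> // -[c ?]; case: nex; exists b, c.
case: cid => b' /= [c [-> Fcb']]; split=> [[<-]|[c' [cc' Fc'b]]]; first by exists c.
have cE : c = c' by apply/funext => i; have /(congr1 (@^~ i)) [] := cc'.
by congr Some; apply: (Ffun c) => //; rewrite cE.
Qed.

Lemma option_ext (u v : option X) :
  (forall b, u = Some b <-> v = Some b) -> u = v.
Proof.
case: u v => [x|] [y|] // uv; first by apply/esym/(uv x).
- by case: (uv x) => /(_ erefl).
- by case: (uv y) => _ /(_ erefl).
Qed.

Lemma some_inj (c d : 'I_n -> X) : Some \o c = Some \o d -> c = d.
Proof. by move=> cd; apply/funext => i; have /(congr1 (@^~ i)) [] := cd. Qed.

Lemma some_upd (c : 'I_n -> X) i b : upd (Some \o c) i (Some b) = Some \o upd c i b.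
Proof. by apply/funext => j; rewrite /upd /=; case: eqP. Qed.

Variables (G : menger2 n) (A : set X) (P : G -> set (('I_n -> X) * X)).
Hypothesis repP : representation A P.

Lemma sink_ext_rep g a b :
  sink_ext (P g) a = Some b <-> exists c, a = Some \o c /\ P g (c, b).
Proof. by apply: (@sink_extP A); case: repP. Qed.

Lemma sink_ext_strict g a i : a i = None -> sink_ext (P g) a = None.
Proof.
case E : (sink_ext _ a) => [b|//].
by have /sink_ext_rep[c [-> _]] := E.
Qed.

Lemma sink_ext_mcomp x y :
  sink_ext (P (mcomp x y)) = mcomp (sink_ext (P x)) (fun i => sink_ext (P (y i))).
Proof.
have [_ Pm _] := repP; apply/funext => a; apply: option_ext => b.
rewrite sink_ext_rep /= /tfun_mcomp sink_ext_rep Pm; split.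
- move=> [c [ac [d [/= Pyd Pxd]]]]; exists d; split=> //.
  by apply/funext => i; apply/sink_ext_rep; exists c.
- move=> [d [yd Pxd]].
  have yd' i : exists c, a = Some \o c /\ P (y i) (c, d i).
    by apply/sink_ext_rep; have /(congr1 (@^~ i)) := yd.
  (* As [n > 0], position 0 supplies a tuple [c]; injectivity of [Some] makes the tuples found at
     the other positions equal to it. *)
  have [c [ac _]] := yd' (Ordinal n_gt0).
  exists c; split=> //; exists d; split=> //= i.
  by have [c' []] := yd' i; rewrite ac => /some_inj ->.
Qed.

Lemma sink_ext_oplus i x y :
  sink_ext (P (oplus i x y)) = oplus i (sink_ext (P x)) (sink_ext (P y)).
Proof.
have [_ _ Po] := repP; apply/funext => a; apply: option_ext => b.
rewrite sink_ext_rep /= /tfun_oplus Po; split.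
- move=> [c [ac [d [/= Pyd Pxd]]]].
  have -> : sink_ext (P y) a = Some d by apply/sink_ext_rep; exists c.
  by apply/sink_ext_rep; exists (upd c i d); rewrite ac some_upd.
- case Ey : (sink_ext (P y) a) => [d|]; last first.
    by rewrite (@sink_ext_strict x _ i) // /upd eqxx.
  have /sink_ext_rep[c [ac Pyd]] := Ey.
  rewrite ac some_upd => /sink_ext_rep[c' [/some_inj <- Pxd]].
  by exists c; split=> //; exists d.
Qed.

End SinkExtension.

(** * A faithful representation built from the four conditions *)

Section FaithfulRepresentation.
Variables (n : nat) (G : menger2 n).
Hypothesis n_gt0 : (0 < n)%N.
Hypotheses (hR1 : cond_R1 G) (hR2 : cond_R2 G) (hR3 : cond_R3 G).
Hypothesis hR4 : cond_R4 G.

(* [inr i] plays the role of the selector e_i. *)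
Definition mu_sum (s : seq ('I_n * G)) (i : 'I_n) : G + 'I_n :=
  if mu i s is Some g then inl g else inr i.

Definition lam (g : G) : set (('I_n -> G + 'I_n) * (G + 'I_n)) :=
  [set p | (exists h, p = (inl \o h, inl (mcomp g h))) \/
           (exists s, p = (mu_sum s, inl (oplus_string g s)))].

Lemma mu_mem i (s : seq ('I_n * G)) h : mu i s = Some h -> i \in unzip1 s.
Proof.
elim: s => //= -[j x] s IHs; rewrite inE eq_sym.
by case: eqP => //= _ /IHs.
Qed.

Lemma mu_sum_inj s t : mu_sum s = mu_sum t -> forall i, mu i s = mu i t.
Proof.
move=> st i; have /(congr1 (@^~ i)) := st; rewrite /mu_sum.
by case: (mu i s) => [x|]; case: (mu i t) => [y|] // [->].
Qed.

(** When all entries of [mu_sum s] lie in [G], every index occurs in [s] and [cond_R3] applies.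
    Hence the two clauses of [lam] agree where they overlap. *)
Lemma mu_sum_inl s h g : mu_sum s = inl \o h -> oplus_string g s = mcomp g h.
Proof.
move=> sh; have muE i : mu i s = Some (h i).
  by have /(congr1 (@^~ i)) := sh; rewrite /mu_sum /=; case: (mu i s) => // x [->].
rewrite hR3 => [|i]; last exact: mu_mem (muE i).
by congr (mcomp _ _); apply/funext => i; rewrite muE.
Qed.

Lemma lam_inl g h z : lam g (inl \o h, z) <-> z = inl (mcomp g h).
Proof.
split=> [[[k [hk ->]]|[s [hs ->]]]|->]; last by left; exists h.
- congr (inl (mcomp _ _)); apply/funext => i.
  by have /(congr1 (@^~ i)) [] := hk.
- by rewrite (mu_sum_inl _ (esym hs)).
Qed.

(** By [cond_R4] the value depends on the tuple [mu_sum s] only, not on the string [s]. *)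
Lemma lam_mu g s z : lam g (mu_sum s, z) <-> z = inl (oplus_string g s).
Proof.
split=> [[[k [hk ->]]|[t [st ->]]]|->]; last by right; exists s.
- by rewrite (mu_sum_inl _ hk).
- by congr inl; apply: hR4 => i; rewrite (mu_sum_inj st).
Qed.

Variant lam_dom : ('I_n -> G + 'I_n) -> Prop :=
| LamInl h : lam_dom (inl \o h)
| LamMu s : lam_dom (mu_sum s).

Lemma lamW g c z : lam g (c, z) -> lam_dom c.
Proof. by case=> [[h [-> _]]|[s [-> _]]]; constructor. Qed.

(** Prefixing a factor alters only entry [i], so [oplus i x h] acts on [mu_sum s] as [x] acts on the
    tuple of the longer string. *)
Lemma upd_mu_sum s i h : upd (mu_sum s) i (inl (oplus_string h s)) = mu_sum ((i, h) :: s).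
Proof. by apply/funext => j; rewrite /upd /mu_sum /= eq_sym; case: eqP. Qed.

Lemma upd_inl (h : 'I_n -> G) i x :
  upd (inl \o h) i (inl x) = inl \o upd h i x :> ('I_n -> G + 'I_n).
Proof. by apply/funext => j; rewrite /upd /=; case: eqP. Qed.

Lemma oplus_string_mcomp (s : seq ('I_n * G)) x y :
  oplus_string (mcomp x y) s = mcomp x (fun i => oplus_string (y i) s).
Proof.
by elim: s y => [//|[j z] s IHs] y; rewrite /oplus_string /= hR2 -/(oplus_string _ _) IHs.
Qed.

(** Composition rests on [mcompA] for tuples over [G] and on [cond_R2] for tuples of strings;
    [oplus] rests on [cond_R1] and [upd_mu_sum] respectively. *)
Lemma lam_representation : representation setT lam.
Proof.
split=> [g|x y|i x y].
- split=> // c z z' /[dup] /lamW [h|s].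
  + by rewrite !lam_inl => -> ->.
  + by rewrite !lam_mu => -> ->.
- apply/seteqP; split=> -[c z].
  + move=> /[dup] /lamW [h|s].
    * rewrite lam_inl => ->; exists (inl \o (fun i => mcomp (y i) h)).
      by split=> [i|] /=; apply/lam_inl => //; rewrite mcompA.
    * rewrite lam_mu => ->; exists (inl \o (fun i => oplus_string (y i) s)).
      by split=> [i|] /=; [apply/lam_mu|apply/lam_inl; rewrite oplus_string_mcomp].
  (* Since [n > 0], some [lam (y i)] is defined at [c], which fixes the form of [c]. *)
  + move=> [b /= [yb xb]]; have cD := lamW (yb (Ordinal n_gt0)).
    case: cD yb => [h|s] yb.
    * have bE : b = inl \o (fun i => mcomp (y i) h).
        by apply/funext => i; have /lam_inl := yb i.
      by move: xb; rewrite bE !lam_inl mcompA.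
    * have bE : b = inl \o (fun i => oplus_string (y i) s).
        by apply/funext => i; have /lam_mu := yb i.
      by move: xb; rewrite bE lam_inl lam_mu oplus_string_mcomp.
- apply/seteqP; split=> -[c z].
  + move=> /[dup] /lamW [h|s].
    * rewrite lam_inl => ->; exists (inl (mcomp y h)); split; first exact/lam_inl.
      by rewrite /= upd_inl lam_inl hR1.
    * rewrite lam_mu => ->; exists (inl (oplus_string y s)).
      by split; [exact/lam_mu|rewrite /= upd_mu_sum lam_mu].
  + move=> [b /= [yb xb]]; have cD := lamW yb.
    case: cD yb xb => [h|s] yb xb.
    * by move: yb xb => /lam_inl ->; rewrite upd_inl !lam_inl hR1.
    * by move: yb xb => /lam_mu ->; rewrite upd_mu_sum !lam_mu.
Qed.

(** The tuple [inr] is [mu_sum [::]], and the empty string leaves [g] unchanged. *)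
Lemma sink_lam_inr g : sink_ext (lam g) (Some \o inr) = Some (inl g).
Proof.
by apply/(sink_ext_rep lam_representation); exists inr; split=> //; right; exists [::].
Qed.

End FaithfulRepresentation.

(** * The determining pair attached to a tuple [a] *)

Section UnitaryAction.
Variables (n : nat) (G : menger2 n) (U : unitary_extension G).

(** With selectors each [oplus] is a composition, so a string collapses to a single one. The
    [mu_star] axiom of determining pairs thereby becomes a case of [eq_at_mcomp]. *)
Lemma emb_oplus_string (g : G) s :
  emb U (oplus_string g s) = mcomp (emb U g) (fun i => mu_star U i s).
Proof.
have [e1 e2 e3] := sel_selectors U.
elim: s g => [|[j x] s IHs] g /=; first by rewrite -[RHS]/(mcomp _ (sel U)) e1.
rewrite /oplus_string /= -/(oplus_string _ _) IHs emb_oplus -e3 mcompA.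
congr (mcomp _ _); apply/funext => i; rewrite /upd /mu_star /= eq_sym.
case: eqP => [_|_]; last by rewrite e2.
by rewrite -[LHS]/(mcomp (emb U x) (fun i => mu_star U i s)) IHs.
Qed.

Variable X : Type.
Variable phi : U -> tfun_menger n (option X).
Hypothesis phi_mcomp :
  forall x y, phi (mcomp x y) = mcomp (phi x) (fun i => phi (y i)).
Hypothesis phi_oplus : forall i x y, phi (oplus i x y) = oplus i (phi x) (phi y).
Hypothesis phi_sel : forall i, phi (sel U i) = @^~ i.
Variables (A : set X) (P : G -> set (('I_n -> X) * X)).
Hypothesis repP : representation A P.
Hypothesis phi_emb : forall g, phi (emb U g) = sink_ext (P g).

Variable a : 'I_n -> X.
Hypothesis Aa : forall i, A (a i).

Definition val_at (x : U) : option X := phi x (Some \o a).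
Definition eq_at (x y : U) : Prop := val_at x = val_at y.
Definition undef_at : set U := [set x | val_at x = None].
Definition class_at (b : X) : set U := [set x | val_at x = Some b].
(** The entries of [a] together with the values at [a] of the functions [P g] defined there. *)
Definition range_at : set X :=
  [set b | exists2 x, (range (emb U) `|` range (sel U)) x & val_at x = Some b].

Lemma val_at_mcomp x y : val_at (mcomp x y) = phi x (fun i => val_at (y i)).
Proof. by rewrite /val_at phi_mcomp. Qed.

Lemma val_at_oplus i x y :
  val_at (oplus i x y) = phi x (upd (Some \o a) i (val_at y)).
Proof. by rewrite /val_at phi_oplus. Qed.

Lemma val_at_sel i : val_at (sel U i) = Some (a i).
Proof. by rewrite /val_at phi_sel. Qed.

Lemma val_at_emb g b : val_at (emb U g) = Some b <-> P g (a, b).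
Proof.
rewrite /val_at phi_emb (sink_ext_rep repP).
by split=> [[c [/some_inj -> //]]|Pab]; exists a.
Qed.

(** Elements of [G] inherit strictness from [sink_ext], whereas projections may ignore a [None]
    entry. This yields the l-ideal property of [undef_at]. *)
Lemma emb_strict g c i : c i = None -> phi (emb U g) c = None.
Proof. by move=> ci; rewrite phi_emb; apply: (sink_ext_strict repP) ci. Qed.

Lemma eclass_class_at x b : val_at x = Some b -> eclass eq_at x = class_at b.
Proof.
by move=> xb; apply/seteqP; split=> y; rewrite /eclass /eq_at /class_at /= xb.
Qed.

Lemma class_at_inj x b b' : class_at b = class_at b' -> val_at x = Some b -> b = b'.
Proof.
move=> bb' xb; have : class_at b' x by rewrite -bb'.
by rewrite /class_at /= xb => -[].
Qed.

Lemma eq_at_mcomp x ys zs :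
  (forall i, eq_at (ys i) (zs i)) -> eq_at (mcomp x ys) (mcomp x zs).
Proof.
move=> yz; rewrite /eq_at !val_at_mcomp; congr (phi x _).
by apply/funext => i; exact: yz.
Qed.

Lemma determining_pair_at : determining_pair eq_at undef_at.
Proof.
split.
- by move=> x y; exact: esym.
- by move=> x y z; exact: etrans.
- by move=> x _; exists x.
- apply/seteqP; split=> // _ [[i _ <-]].
  by rewrite /undef_at /= val_at_sel.
- move=> g _ [x xE <-]; have [e1 _ _] := sel_selectors U.
  by rewrite /eclass /= -{1}(e1 (emb U g)); exact: eq_at_mcomp.
- move=> g s _ [x xE <-]; rewrite /eclass /= emb_oplus_string.
  exact: eq_at_mcomp.
- move=> x y xs ys [xy [h hx] _] xys g; split=> [|i].
  (* Representatives [k i] in [G] of the arguments give [mcomp g k] in [G], which keeps both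
     composites in the saturation of [G]. *)
  + have /choice [k kx] : forall i, exists k, eq_at (emb U k) (xs i).
      by move=> i; have [_ [k]] := xys i; exists k.
    have ge : eq_at (mcomp (emb U g) xs) (mcomp (emb U g) ys).
      by apply: eq_at_mcomp => i; have [] := xys i.
    have gk : eq_at (emb U (mcomp g k)) (mcomp (emb U g) xs).
      by rewrite emb_mcomp; exact: eq_at_mcomp.
    by split=> //; exists (mcomp g k) => //; exact: etrans gk ge.
  + have ge z t : eq_at z t -> eq_at (oplus i (emb U g) z) (oplus i (emb U g) t).
      by rewrite /eq_at !val_at_oplus => ->.
    split; first exact: ge.
    * by exists (oplus i g h); rewrite emb_oplus; exact: ge.
    * by exists (oplus i g h); rewrite emb_oplus; apply: ge; exact: etrans hx xy.
- move=> [x xW]; split.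
    exists x; first by exists x.
    apply/seteqP; split=> y; rewrite /undef_at /eclass /eq_at /= xW //.
  move=> i g y w; rewrite /undef_at /= => yW; split.
  + rewrite emb_mcomp val_at_mcomp; apply: (@emb_strict _ _ i).
    by rewrite /upd eqxx.
  + rewrite emb_oplus val_at_oplus; apply: (@emb_strict _ _ i).
    by rewrite /upd eqxx.
Qed.

Lemma set_bij_at : set_bij range_at (index_classes eq_at undef_at) class_at.
Proof.
split.
- move=> b [x Gx xb]; split.
  + by exists x; [exists x|rewrite (eclass_class_at xb)].
  + move=> bW; have : undef_at x by rewrite -bW.
    by rewrite /undef_at /= xb.
  + by exists x.
- by move=> b b' /set_mem[x _ xb] _ /class_at_inj; apply; exact: xb.
- move=> H [[y _ HE] HW [x [Hx Gx]]].
  (* If [x] had no value at [a], its class [H] would be the excluded [undef_at]. *)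
  case xb : (val_at x) => [b|].
    exists b; first by exists x.
    by rewrite HE -(@eclass_class_at y b) // -xb; move: Hx; rewrite HE.
  case: HW; move: Hx; rewrite HE /eclass /eq_at /= xb => ->.
  by apply/seteqP; split=> z.
Qed.

Lemma simplest_at :
  simplest_representation range_at
    (pair_representation range_at class_at eq_at).
Proof.
exists U, eq_at, undef_at, class_at; split=> //.
- exact: determining_pair_at.
- exact: set_bij_at.
Qed.

(** The tuple [c] need not be [a]: representatives of its entries evaluate at [a] to [c], so
    [val_at_mcomp] reads the value of [P g] at [c] off the value of a composite at [a]. *)
Lemma pair_representation_at_sub g :
  pair_representation range_at class_at eq_at g `<=` P g.
Proof.
move=> [c b] [/= [cB cE] bB gc].
(* Each of the three kinds of domain tuples provides elements of the classes
   of its entries, and any one such tuple of elements determines [b]. *)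
have [x xc] : exists x, forall i, class_at (c i) (x i).
  by case: cE => [[h hE]|hE|[s hE]];
    [exists (fun i => emb U (h i))|exists (sel U)|exists (fun i => mu_star U i s)];
    move=> i; rewrite hE.
have : class_at b (mcomp (emb U g) x) by apply: gc; exists x.
rewrite /class_at /= val_at_mcomp.
have -> : (fun i => val_at (x i)) = Some \o c by apply/funext => i; exact: xc.
by rewrite phi_emb => /(sink_ext_rep repP) [d [/some_inj ->]].
Qed.

Lemma pair_representation_at g b :
  P g (a, b) -> pair_representation range_at class_at eq_at g (a, b).
Proof.
move=> /val_at_emb gb; split=> /=.
- split=> [i|]; first by exists (sel U i); [right; exists i|exact: val_at_sel].
  (* The tuple [a] itself is the one formed by the classes of the selectors. *)
  by constructor 2 => i; rewrite (eclass_class_at (val_at_sel i)).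
- by exists (emb U g) => //; left; exists g.
- move=> _ [x xc <-]; rewrite /class_at /= val_at_mcomp -gb /val_at.
  by congr (phi _ _); apply/funext => i; exact: xc.
Qed.

Lemma range_at_sub : range_at `<=` A.
Proof.
move=> b [_ [[g _ <-]|[i _ <-]]].
- by move=> /val_at_emb Pab; have [Pf _ _] := repP; have [/(_ _ _ Pab)[]] := Pf g.
- by rewrite val_at_sel => -[<-].
Qed.

Lemma range_at_entry i : range_at (a i).
Proof. by exists (sel U i); [right; exists i|exact: val_at_sel]. Qed.

End UnitaryAction.

(** * Extending a representation, and the decomposition into simplest ones *)

Lemma extension_of_representation (n : nat) (hn : (0 < n)%N) (G : menger2 n)
    (hR1 : cond_R1 G) (hR2 : cond_R2 G) (hR3 : cond_R3 G) (hR4 : cond_R4 G)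
    (X : Type) (A : set X) (P : G -> set (('I_n -> X) * X))
    (hP : representation A P) :
  exists (U : unitary_extension G) (phi : U -> tfun_menger n (option X)),
    [/\ forall x y, phi (mcomp x y) = mcomp (phi x) (fun i => phi (y i)),
        forall i x y, phi (oplus i x y) = oplus i (phi x) (phi y),
        forall i, phi (sel U i) = @^~ i
      & forall g, phi (emb U g) = sink_ext (P g)].
Proof.
have hL := lam_representation hn hR1 hR2 hR3 hR4.
(* As [P] may identify elements, injectivity comes from the factor [lam]; the second factor recovers
   [P]. *)
pose f g : prod_menger (tfun_menger n (option (G + 'I_n))) (tfun_menger n (option X)) :=
  (sink_ext (lam g), sink_ext (P g)).
have f_inj : injective f.
  move=> x y [xy _]; have := sink_lam_inr hn hR1 hR2 hR3 hR4 x.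
  by rewrite xy sink_lam_inr // => -[].
have f_mcomp x y : f (mcomp x y) = mcomp (f x) (fun i => f (y i)).
  by rewrite /f (sink_ext_mcomp hn hL) (sink_ext_mcomp hn hP).
have f_oplus i x y : f (oplus i x y) = oplus i (f x) (f y).
  by rewrite /f (sink_ext_oplus hL) (sink_ext_oplus hP).
(* At [Some \o inr] the first component of [f x] takes a value in the left summand, a projection one
   in the right summand. *)
have f_e x i : f x <> (@^~ i, @^~ i).
  move=> [/(congr1 (@^~ (Some \o inr)))].
  by rewrite (sink_lam_inr hn hR1 hR2 hR3 hR4 x).
have [U [p [pm po pf pe]]] := extension_of_embedding
  (prod_selectors (@tfun_selectors _ _) (@tfun_selectors _ _))
  f_inj f_mcomp f_oplus f_e.
exists U, (fun x => (p x).2); split=> [x y|i x y|i|g].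
- by rewrite pm.
- by rewrite po.
- by rewrite pe.
- by rewrite pf.
Qed.

Theorem theorem5 (n : nat) (hn : (0 < n)%N) (G : menger2 n)
    (hR1 : cond_R1 G) (hR2 : cond_R2 G) (hR3 : cond_R3 G)
    (hR4 : cond_R4 G)
    (X : Type) (A : set X) (P : G -> set (('I_n -> X) * X))
    (hP : representation A P) :
  exists (I : Type) (B : I -> set X) (Q : I -> G -> set (('I_n -> X) * X)),
    (forall k : I, simplest_representation (B k) (Q k)) /\
    is_union_of A P B Q.
Proof.
have [U [phi [pm po ps pe]]] := extension_of_representation hn hR1 hR2 hR3 hR4 hP.
exists {a : 'I_n -> X | forall i, A (a i)}, (fun a => range_at phi (proj1_sig a)),
  (fun a => pair_representation (range_at phi (proj1_sig a))
              (class_at phi (proj1_sig a)) (eq_at phi (proj1_sig a))).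
split=> [[a Aa]|]; first exact: (simplest_at pm po ps hP pe).
split=> [|g]; apply/seteqP; split.
- move=> b Ab.
  (* The constant tuple has [b] as an entry because [n > 0]. *)
  exists (exist (fun a : 'I_n -> X => forall i, A (a i)) (fun=> b) (fun=> Ab)) => //.
  exact: (range_at_entry ps _ (Ordinal hn)).
- by move=> b [[a Aa] _]; exact: (range_at_sub ps hP pe Aa).
(* The pair is covered by the member indexed by its own tuple [a]. *)
- move=> [a b] Pab; have [/(_ g)[/(_ _ _ Pab)[Aa _] _] _ _] := hP.
  exists (exist (fun a : 'I_n -> X => forall i, A (a i)) a Aa) => //.
  exact: (pair_representation_at pm ps hP pe).
- by move=> p [[a Aa] _]; exact: (pair_representation_at_sub pm hP pe).
Qed.
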